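(* For all sufficiently large $n$ we have \[\operatorname{inv}(n)\geq n-\sqrt{2n\log(n)}.\] Moreover, the probability that a uniformly random labelled $n$-vertex tournament has inversion number at least $n-\sqrt{2n\log(n)}$ tends to $1$ as $n\to\infty$.
   Context: For a digraph $D$ and $X\subseteq V(D)$, inverting $X$ in $D$ means reversing the direction of every edge with both endpoints in $X$. A family $X_1,\dots,X_k\subseteq V(D)$ is a decycling family of $D$ if inverting $X_1,\dots,X_k$ in turn yields an acyclic digraph; $\operatorname{inv}(D)$ is the minimum size of a decycling family. For $n\in\mathbb{N}$, $\operatorname{inv}(n)$ denotes the maximum inversion number of an oriented graph (equivalently, a tournament) on $n$ vertices. Logarithms are base $2$. *)

(* Defs.v *)
From mathcomp Require Import all_boot all_order all_algebra.
From mathcomp Require Import boolp reals exp.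

Set Implicit Arguments.
Unset Strict Implicit.
Unset Printing Implicit Defensive.

Import Order.TTheory GRing.Theory Num.Theory.

Section Digraphs.
Local Open Scope nat_scope.
Variable V : finType.

(* A digraph on V is its set of edges; (x, y) is the edge from x to y. *)
Definition digraph := {set V * V}.

Implicit Types (D : digraph) (X : {set V}) (Xs : seq {set V}).

Definition edge D : rel V := fun x y => (x, y) \in D.

Definition oriented D : bool :=
  [forall x, ~~ edge D x x] && [forall x, forall y, ~~ (edge D x y && edge D y x)].

Definition tournament D : bool :=
  oriented D && [forall x, forall y, (x != y) ==> (edge D x y || edge D y x)].

Definition invert D X : digraph :=
  [set e : V * V | if (e.1 \in X) && (e.2 \in X) then (e.2, e.1) \in D
                   else e \in D].

(* Nonempty duplicate-free cyclic sequences are directed cycles; those of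
   length 1 and 2 are loops and pairs of opposite edges. *)
Definition acyclic D : Prop :=
  forall c : seq V, c != [::] -> ~ ucycle (edge D) c.

Definition decycling D Xs : Prop := acyclic (foldl invert D Xs).

Definition has_decycling_of_size D : pred nat :=
  fun k => `[< exists Xs, size Xs = k /\ decycling D Xs >].

(* The value 0 is a convention for digraphs without any decycling family; it
   never applies to oriented graphs, see [oriented_has_decycling]. *)
Definition inversion_number D : nat :=
  if pselect (exists k, has_decycling_of_size D k) is left exk
  then ex_minn exk else 0.

Let backward D := [set e in D | enum_rank e.2 < enum_rank e.1].

Lemma forward_acyclic D : oriented D -> backward D = set0 -> acyclic D.
Proof.
move=> /andP[/forallP irr _] B0 [//|x s] _ /andP[/= ps _].
have sub : subrel (edge D) (fun y z => enum_rank y < enum_rank z).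
  move=> y z Dyz; rewrite ltnNge leq_eqVlt negb_or; apply/andP; split.
    apply: contraL (Dyz) => /eqP/val_inj/enum_rank_inj->; exact: irr.
  by move: (in_set0 (y, z)); rewrite -B0 inE /= [_ \in _]Dyz /= => ->.
move: ps => /(sub_path sub) /order_path_min.
move=> /(_ (fun b a c => @ltn_trans _ _ _)) /allP /(_ x).
by rewrite mem_rcons mem_head ltnn => /(_ isT).
Qed.

Lemma invert_oriented D X : oriented D -> oriented (invert D X).
Proof.
move=> /andP[/forallP irr /forallP asym]; apply/andP; split.
  by apply/forallP => x; rewrite /edge inE /= if_same; exact: irr.
apply/forallP => x; apply/forallP => y; have /forallP/(_ y) := asym x.
by rewrite /edge !inE /= [(y \in X) && _]andbC; case: ifP => // _; rewrite andbC.
Qed.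

Lemma oriented_has_decycling D :
  oriented D -> exists k, has_decycling_of_size D k.
Proof.
have [m] := ubnP #|backward D|; elim: m D => // m IH D ltm oD.
have [B0|[[x y] Bxy]] := set_0Vmem (backward D).
  by exists 0; apply/asboolP; exists [::]; split=> //; exact: forward_acyclic.
have [|k /asboolP[Xs [sz dXs]]] := IH _ _ (invert_oriented [set x; y] oD); last first.
  by exists k.+1; apply/asboolP; exists ([set x; y] :: Xs); rewrite /= sz.
move: ltm; rewrite ltnS; apply: leq_trans; apply/proper_card/properP; split; last first.
  exists (x, y) => //; move: Bxy; rewrite !inE /= !eqxx orbT /= => /andP[Dxy _].
  have /andP[_ /forallP/(_ x)/forallP/(_ y)] := oD.
  by rewrite /edge Dxy /= => /negbTE->.
apply/subsetP => -[u v]; rewrite !inE /=.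
case: ifP => // uv /andP[Dvu ltvu].
move: Bxy; rewrite inE /= => /andP[Dxy ltyx].
by case/andP: uv Dvu ltvu => /orP[]/eqP-> /orP[]/eqP->;
  rewrite ?ltnn ?Dxy ?andbF //= ltnNge ltnW.
Qed.

End Digraphs.

(* Every digraph on n vertices is isomorphic to one on 'I_n. *)
Definition max_inversion_number (n : nat) : nat :=
  \max_(D : digraph 'I_n | oriented D) inversion_number D.

Section Probability.
Local Open Scope ring_scope.

Definition log2 (R : realType) (x : R) : R := ln x / ln 2.

(* Probability that a uniformly random tournament with vertex set 'I_n has
   the property P. *)
Definition random_tournament_prob (R : realType) (n : nat)
    (P : digraph 'I_n -> bool) : R :=
  #|[set D : digraph 'I_n | tournament D && P D]|%:R
  / #|[set D : digraph 'I_n | tournament D]|%:R.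

End Probability.

(* Main.v *)
Require Import Defs.
From mathcomp Require Import all_boot all_order all_algebra.
From mathcomp Require Import boolp reals exp.
From mathcomp Require Import zify ring lra.
Import Order.TTheory GRing.Theory Num.Theory.

(* Inverting X_1, ..., X_k flips the pair {x, y} exactly when the (x, y) entry
   of M = sum_i 1_{X_i} 1_{X_i}^T over F_2 is nonzero, so a tournament with
   inversion number at most k = n - s is determined by a linear order and a
   symmetric matrix M of rank at most k. Some k rows of M span its row space,
   and M is then recovered from these rows: there are at most
   C(n, s) 2^(C(n+1,2) - C(s+1,2)) such matrices. Hence the proportion of
   tournaments with inversion number at most n - s is at most
   n! n^s 2^n / 2^C(s+1,2). For s slightly above sqrt(2 n log n) the denominator
   is at least n^n; as n! 2^n <= 3 (8/9)^n n^n and n^s is subexponential, the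
   proportion tends to 0. *)

Section Combinatorics.
Local Open Scope nat_scope.

Lemma tournamentP (V : finType) (D : digraph V) :
  reflect [/\ irreflexive (edge D),
              forall x y, ~~ (edge D x y && edge D y x)
            & forall x y, x != y -> edge D x y || edge D y x]
          (tournament D).
Proof.
apply: (iffP andP) => [[/andP[/forallP irr /forallP asym] /forallP tot]|].
  split=> [x|x y|x y]; first exact/negbTE/irr.
    by have /forallP/(_ y) := asym x.
  by have /forallP/(_ y)/implyP := tot x.
case=> irr asym tot; split; last first.
  by apply/forallP => x; apply/forallP => y; apply/implyP/tot.
apply/andP; split; first by apply/forallP => x; rewrite irr.
by apply/forallP => x; apply/forallP => y; apply: asym.
Qed.

Lemma acyclic_tournament_trans (V : finType) (E : digraph V) :
  tournament E -> acyclic E -> transitive (edge E).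
Proof.
move=> /tournamentP[irr asym tot] acE y x z Exy Eyz.
have nxy : x != y by apply/eqP => xy; rewrite xy irr in Exy.
have nyz : y != z by apply/eqP => yz; rewrite yz irr in Eyz.
have nxz : x != z.
  by apply/eqP => xz; move: (asym x y); rewrite Exy xz Eyz.
case/orP: (tot x z nxz) => // Ezx.
case: (acE [:: x; y; z]) => //.
by rewrite /ucycle /= Exy Eyz Ezx !inE negb_or nxy nxz nyz.
Qed.

(* In an acyclic tournament, the in-degrees list the vertices in order. *)
Lemma acyclic_tournament_order {n : nat} (E : digraph 'I_n) :
  tournament E -> acyclic E ->
  exists2 d : {ffun 'I_n -> 'I_n}, injectiveb d &
    forall x y, edge E x y = (d x < d y).
Proof.
move=> tE acE; have Etr := @acyclic_tournament_trans _ _ tE acE.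
have /tournamentP[irr asym tot] := tE.
pose N x := [set y | edge E y x].
have ltN x : #|N x| < n.
  rewrite -[ltnRHS]card_ord -cardsT; apply/proper_card/properP.
  by split; [exact: subsetT | exists x; rewrite ?inE // irr].
have NE x y : edge E x y -> #|N x| < #|N y|.
  move=> Exy; apply/proper_card/properP; split; last first.
    by exists x; rewrite inE // irr.
  by apply/subsetP => z; rewrite !inE => Ezx; apply: Etr Exy.
exists [ffun x => Ordinal (ltN x)] => [|x y].
  apply/injectiveP => x y; rewrite !ffunE => -[Nxy].
  apply/eqP/negPn/negP => /tot /orP[] /NE; rewrite Nxy ltnn //.
rewrite !ffunE /=; apply/idP/idP => [/NE //|ltxy].
have: x != y by apply/eqP => xy; rewrite xy ltnn in ltxy.
by case/tot/orP => // /NE; rewrite ltnNge (ltnW ltxy).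
Qed.

Definition flips (V : finType) (Xs : seq {set V}) (x y : V) : bool :=
  odd (count (fun X : {set V} => (x \in X) && (y \in X)) Xs).

Lemma flipsC (V : finType) (Xs : seq {set V}) x y : flips V Xs x y = flips V Xs y x.
Proof. by congr odd; apply: eq_count => X /=; rewrite andbC. Qed.

Lemma edge_invert_family {V : finType} (D : digraph V) (Xs : seq {set V}) x y :
  edge (foldl (@invert V) D Xs) x y =
  if flips V Xs x y then edge D y x else edge D x y.
Proof.
elim: Xs D => [|X Xs IH] D //=.
rewrite IH /flips /= oddD oddb /edge !inE /= [(y \in X) && _]andbC.
by case: (_ && _); case: odd.
Qed.

Lemma tournament_invert_family {V : finType} (D : digraph V) (Xs : seq {set V}) :
  tournament D -> tournament (foldl (@invert V) D Xs).
Proof.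
move=> /tournamentP[irr asym tot]; apply/tournamentP.
split=> [x|x y|x y nxy]; rewrite !edge_invert_family ?(flipsC _ _ y x).
- by rewrite if_same irr.
- by case: ifP => _; apply: asym.
- by case: ifP => _; [rewrite orbC|]; apply: tot.
Qed.

Definition flip_mx {n : nat} (Xs : seq {set 'I_n}) : 'M['F_2]_n :=
  (\sum_(X <- Xs) (\col_i (i \in X)%:R) *m (\row_j (j \in X)%:R))%R.

Lemma flip_mxE {n : nat} (Xs : seq {set 'I_n}) i j :
  flip_mx Xs i j =
    (count (fun X : {set 'I_n} => (i \in X) && (j \in X)) Xs)%:R%R.
Proof.
rewrite /flip_mx summxE -sum1_count natr_sum [RHS]big_mkcond.
apply: eq_bigr => X _; rewrite !mxE big_ord1 !mxE -natrM mulnb.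
by case: (_ && _).
Qed.

Lemma flip_mx_neq0 {n : nat} (Xs : seq {set 'I_n}) i j :
  (flip_mx Xs i j != 0)%R = flips _ Xs i j.
Proof. by rewrite flip_mxE -(dvdn_pcharf (pchar_Fp _)) // dvdn2 negbK. Qed.

Lemma flip_mx_sym {n : nat} (Xs : seq {set 'I_n}) i j :
  flip_mx Xs i j = flip_mx Xs j i.
Proof.
by rewrite !flip_mxE; congr (_%:R)%R; apply: eq_count => X; rewrite andbC.
Qed.

Lemma rank_flip_mx {n : nat} (Xs : seq {set 'I_n}) : \rank (flip_mx Xs) <= size Xs.
Proof.
rewrite /flip_mx; elim: Xs => [|X Xs IH]; first by rewrite big_nil mxrank0.
rewrite big_cons; apply: leq_trans (mxrank_add _ _) _.
exact: (leq_add (mulmx_max_rank _ _) IH).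
Qed.

Definition low_rank_sym (n k : nat) : {set 'M['F_2]_n} :=
  [set M : 'M['F_2]_n | [forall i, forall j, M i j == M j i] & \rank M <= k].

Definition flip_order {n : nat} (d : {ffun 'I_n -> 'I_n}) (M : 'M['F_2]_n) :
    digraph 'I_n :=
  [set e | if (M e.1 e.2 != 0)%R then d e.2 < d e.1 else d e.1 < d e.2].

Lemma low_inversion_tournament {n k : nat} (D : digraph 'I_n) :
  tournament D -> inversion_number D <= k ->
  D \in [set flip_order d M | d in [set d : {ffun 'I_n -> 'I_n} | injectiveb d],
                              M in low_rank_sym n k].
Proof.
move=> tD; rewrite /inversion_number; case: pselect => [ex|]; last first.
  by case; apply: oriented_has_decycling; case/andP: tD.
case: ex_minnP => m /asboolP[Xs [<- dXs]] _ lek.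
have [d inj_d dE] :=
  acyclic_tournament_order _ (tournament_invert_family _ Xs tD) dXs.
apply/imset2P; exists d (flip_mx Xs); rewrite ?inE //.
  apply/andP; split; last exact: leq_trans (rank_flip_mx Xs) lek.
  by apply/forallP => i; apply/forallP => j; rewrite flip_mx_sym.
apply/setP => -[x y]; rewrite inE /= flip_mx_neq0 -!dE !edge_invert_family.
by rewrite (flipsC _ _ y x) /edge; case: flips.
Qed.

Definition rows_outside {n : nat} (T : {set 'I_n}) (M : 'M['F_2]_n) : 'M['F_2]_n :=
  (\matrix_(i, j) if i \in T then 0 else M i j)%R.

Definition sym_spanned {n : nat} (T : {set 'I_n}) : {set 'M['F_2]_n} :=
  [set M : 'M['F_2]_n | [forall i, forall j, M i j == M j i]
                      & (M <= rows_outside T M)%MS].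

Lemma low_rank_sym_spanned {n s : nat} (M : 'M['F_2]_n) :
  s <= n -> M \in low_rank_sym n (n - s) ->
  exists2 T : {set 'I_n}, #|T| = s & M \in sym_spanned T.
Proof.
move=> les; rewrite inE => /andP[symM rkM].
pose f := maxrankfun M; pose B := [set f i | i : 'I_(\rank M)].
have leB : #|B| <= n - s.
  by apply: leq_trans (leq_imset_card _ _) _; rewrite card_ord.
have : s <= #|~: B| by have := cardsC B; rewrite card_ord; lia.
case/card_geqP => t [ut st sub]; exists [set x in t].
  by rewrite cardsE (card_uniqP ut).
rewrite inE symM /= -(eq_maxrowsub M); apply/row_subP => i.
have -> : row i (rowsub f M) = row (f i) (rows_outside [set x in t] M).
  apply/rowP => j; rewrite !mxE inE; case: ifP => // /sub.
  by rewrite inE imset_f.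
exact: row_sub.
Qed.

Lemma F2_eq (a b : 'F_2) : (a != 0)%R = (b != 0)%R -> a = b.
Proof. by case: a b => [[|[|a]] ?] [[|[|b]] ?] //= _; apply: val_inj. Qed.

Definition pairs_in {n : nat} (T : {set 'I_n}) : {set 'I_n * 'I_n} :=
  [set e : 'I_n * 'I_n | [&& e.1 <= e.2, e.1 \in T & e.2 \in T]].

(* The rows of [M - N] lie in the common row space of [M] and [N], and its
   columns outside [T] vanish; as [M] is symmetric, a vector of that space is
   determined by its entries outside [T]. *)
Lemma sym_spanned_inj {n : nat} (T : {set 'I_n}) (M N : 'M['F_2]_n) :
  M \in sym_spanned T -> N \in sym_spanned T ->
  (forall i j, ~~ ((i \in T) && (j \in T)) -> M i j = N i j) -> M = N.
Proof.
rewrite !inE => /andP[/forallP symM spM] /andP[_ spN] eqMN.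
have {}symM i j : M i j = M j i by have /forallP/(_ j)/eqP := symM i.
pose R := rows_outside T M.
have eqR : rows_outside T N = R.
  by apply/matrixP => i j; rewrite !mxE; case: ifP => // iT; rewrite eqMN ?iT.
rewrite eqR in spN.
have RM : (R <= M)%MS.
  apply/row_subP => i; case: (boolP (i \in T)) => iT.
    suff -> : row i R = 0%R by apply: sub0mx.
    by apply/rowP => j; rewrite !mxE iT.
  suff -> : row i R = row i M by apply: row_sub.
  by apply/rowP => j; rewrite !mxE (negbTE iT).
have : ((M - N)%R <= M)%MS.
  by rewrite (submx_trans _ RM) // addmx_sub // eqmx_opp.
case/submxP => Y defY; apply/eqP; rewrite -GRing.subr_eq0 defY.
have YR : (Y *m R^T = 0)%R.
  apply/matrixP => i j; rewrite !mxE; case: (boolP (j \in T)) => jT.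
    by rewrite big1 // => l _; rewrite !mxE jT mulr0.
  have /matrixP/(_ i j) := defY; rewrite !mxE eqMN ?(negbTE jT) ?andbF //.
  rewrite GRing.subrr => zE; rewrite [RHS]zE; apply: eq_bigr => l _.
  by rewrite !mxE (negbTE jT) symM.
have [A defA] := submxP spM.
have -> : M = (R^T *m A^T)%R.
  by rewrite -trmx_mul -defA; apply/matrixP => i j; rewrite mxE symM.
by rewrite mulmxA YR mul0mx.
Qed.

Lemma card_sym_spanned {n : nat} (T : {set 'I_n}) :
  #|sym_spanned T| <= 2 ^ #|pairs_in [set: 'I_n] :\: pairs_in T|.
Proof.
pose code (M : 'M['F_2]_n) :=
  [set e in pairs_in [set: 'I_n] :\: pairs_in T | (M e.1 e.2 != 0)%R].
rewrite -card_powerset -(@card_in_imset _ _ code).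
  apply/subset_leq_card/subsetP => _ /imsetP[M _ ->].
  by rewrite inE; apply/subsetP => e; rewrite inE => /andP[].
move=> M N MT NT eqc; apply: (sym_spanned_inj _ _ _ MT NT).
have sym L : L \in sym_spanned T -> forall i j, L i j = L j i.
  by rewrite inE => /andP[/forallP s _] i j; have /forallP/(_ j)/eqP := s i.
move=> i j; wlog leij : i j / i <= j.
  move=> IH nT; case: (leqP i j) => [|/ltnW] leij; first exact: IH.
  by rewrite (sym M) // (sym N) // IH // andbC.
move=> nT; apply: F2_eq.
by have /setP/(_ (i, j)) := eqc; rewrite !inE /= leij nT.
Qed.

Lemma card_pairs_in {n : nat} (T : {set 'I_n}) : #|pairs_in T| = 'C(#|T|.+1, 2).
Proof.
pose sw (e : 'I_n * 'I_n) := (e.2, e.1).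
have sw_inj : injective sw by move=> [a b] [c d] [-> ->].
have U : pairs_in T :|: sw @: pairs_in T = setX T T.
  apply/setP => -[x y]; rewrite !inE /=; apply/orP/andP.
    by case=> [/and3P[]|/imsetP[[a b]]] //; rewrite inE /= => /and3P[_ ? ?] [-> ->].
  move=> [xT yT]; case: (leqP x y) => [|/ltnW] lexy; first by left; apply/and3P.
  by right; apply/imsetP; exists (y, x); rewrite ?inE //; apply/and3P.
have I : pairs_in T :&: sw @: pairs_in T = [set (x, x) | x in T].
  apply/setP => -[x y]; rewrite !inE /=; apply/andP/imsetP.
    case=> /and3P[lexy xT yT] /imsetP[[a b]]; rewrite inE /= => /and3P[leab _ _] [xb ya].
    exists x => //; congr pair; apply/val_inj/anti_leq.
    by rewrite lexy xb ya leab.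
  case=> z zT [-> ->]; rewrite leqnn zT; split=> //.
  by apply/imsetP; exists (z, z); rewrite // inE /= leqnn zT.
have := cardsUI (pairs_in T) (sw @: pairs_in T).
rewrite U I cardsX !card_imset //; last by move=> x y [].
by move=> eqF; rewrite bin2 /= mulSn [#|T| + _]addnC eqF addnn doubleK.
Qed.

Lemma card_low_rank_sym {n s : nat} : s <= n ->
  #|low_rank_sym n (n - s)| * 2 ^ 'C(s.+1, 2) <= n ^ s * 2 ^ 'C(n.+1, 2).
Proof.
move=> les.
pose pool := [set T : {set 'I_n} | #|T| == s].
have sub : low_rank_sym n (n - s) \subset \bigcup_(T in pool) sym_spanned T.
  apply/subsetP => M /(low_rank_sym_spanned _ les)[T cT MT].
  by apply/bigcupP; exists T; rewrite // inE cT.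
have leU := leq_trans (subset_leq_card sub) (unstable.card_big_setU _ _ _).
apply: leq_trans (leq_mul leU (leqnn _)) _.
rewrite big_distrl /=.
have bound T : T \in pool ->
    #|sym_spanned T| * 2 ^ 'C(s.+1, 2) <= 2 ^ 'C(n.+1, 2).
  rewrite inE => /eqP cT.
  apply: leq_trans (leq_mul (card_sym_spanned T) (leqnn _)) _.
  rewrite -expnD leq_exp2l // cardsD (setIidPr _); last first.
    by apply/subsetP => e; rewrite !inE => /and3P[->].
  rewrite !card_pairs_in cT cardsT card_ord subnK //.
  by rewrite leq_bin2l.
have le_sum : \sum_(T in pool) #|sym_spanned T| * 2 ^ 'C(s.+1, 2) <=
              \sum_(T in pool) 2 ^ 'C(n.+1, 2) by apply: leq_sum.
apply: leq_trans le_sum _.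
rewrite sum_nat_const card_draws card_ord leq_mul2r; apply/orP; right.
rewrite (leq_trans (leq_pmulr _ (fact_gt0 s))) // bin_ffact.
elim: s {les pool sub leU bound} => // s IH; rewrite ffactnSr expnSr.
exact: leq_mul IH (leq_subr _ _).
Qed.

Lemma card_tournaments (n : nat) :
  2 ^ 'C(n.+1, 2) <= 2 ^ n * #|[set D : digraph 'I_n | tournament D]|.
Proof.
pose L := [set e : 'I_n * 'I_n | e.1 < e.2].
have -> : 'C(n.+1, 2) = n + #|L|.
  rewrite -[n in n.+1]card_ord -cardsT -card_pairs_in.
  rewrite -(cardsID [set (x, x) | x in [set: 'I_n]]); congr addn.
    rewrite (setIidPr _); last first.
      by apply/subsetP => _ /imsetP[x _ ->]; rewrite !inE /= leqnn.
    by rewrite card_imset ?cardsT ?card_ord // => x y [].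
  apply: eq_card => -[x y]; rewrite !inE /= ltn_neqAle andbT.
  congr andb; congr negb; apply/imsetP/eqP => [[z _ [-> ->]] //|xy].
  by exists x; rewrite ?inE // (val_inj xy).
rewrite expnD leq_mul2l -card_powerset; apply/orP; right.
pose tn (P : {set 'I_n * 'I_n}) : digraph 'I_n :=
  [set e : 'I_n * 'I_n | if e.1 < e.2 then e \in P else (e.2 < e.1) && ((e.2, e.1) \notin P)].
rewrite -(@card_in_imset _ _ tn).
  apply/subset_leq_card/subsetP => _ /imsetP[P _ ->]; rewrite inE.
  apply/tournamentP; split=> [x|x y|x y nxy]; rewrite /edge !inE /= ?ltnn //.
    by case: ltngtP => //= _; case: (_ \in P).
  have : (x : nat) != y by [].
  by case: ltngtP => //= _ _; case: (_ \in P).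
move=> P Q /[!inE] /subsetP PL /subsetP QL /setP eqt.
apply/setP => e; have := eqt e; rewrite !inE.
case: ltnP => // leq21 _.
have nL : e \notin L by rewrite inE -leqNgt.
by rewrite (negbTE (contra (PL e) nL)) (negbTE (contra (QL e) nL)).
Qed.

Lemma card_low_inversion (n s : nat) :
  #|[set D : digraph 'I_n | tournament D & inversion_number D + s <= n]|
    * 2 ^ 'C(s.+1, 2)
  <= n`! * n ^ s * 2 ^ n * #|[set D : digraph 'I_n | tournament D]|.
Proof.
case: (leqP s n) => [les|ltns]; last first.
  rewrite (_ : [set D | _ & _] = set0) ?cards0 //.
  apply/setP => D; rewrite !inE; apply/negbTE/negP => /andP[_].
  by rewrite leqNgt (leq_trans ltns) // leq_addl.
set B := [set D | _ & _].
have sub : B \subset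
    [set flip_order d M | d in [set d : {ffun 'I_n -> 'I_n} | injectiveb d],
                          M in low_rank_sym n (n - s)].
  apply/subsetP => D; rewrite inE => /andP[tD leD].
  by apply: low_inversion_tournament; rewrite // leq_subRL // addnC.
have := subset_leq_card sub; rewrite curry_imset2X.
move=> /leq_trans/(_ (leq_imset_card _ _)).
rewrite cardsX card_inj_ffuns card_ord ffactnn => leB.
apply: leq_trans (leq_mul leB (leqnn _)) _.
rewrite -!mulnA leq_mul2l; apply/orP; right.
apply: leq_trans (card_low_rank_sym les) _.
by rewrite leq_mul2l card_tournaments orbT.
Qed.

End Combinatorics.

Lemma expn_addn1_ge (x k : nat) :
  (x ^ k * (2 * x ^ 2 + 2 * k * x + k ^ 2) <= 2 * x ^ 2 * (x + 1) ^ k + k * x ^ k)%N.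
Proof.
rewrite -mulnn; elim: k => [|k IH]; first by rewrite !expn0; lia.
rewrite -!mulnn !expnSr in IH *; move: IH; set a := ((x + 1) ^ k)%N; set b := (x ^ k)%N.
move=> /(leq_mul (leqnn (x + 1))) IH.
have : (b * k <= b * k * k)%N by case: (k) => [|j]; lia.
lia.
Qed.

Lemma fact_exp_le (n : nat) : (n`! * 9 ^ n <= 3 * 4 ^ n * n ^ n)%N.
Proof.
case: n => [|[|n]] //; elim: n => // n; set m := n.+2 => IH.
have m0 : (0 < m)%N by [].
have growth : (9 * m ^ m <= 4 * (m + 1) ^ m)%N.
  have := expn_addn1_ge m m; rewrite -!mulnn; set a := ((m + 1) ^ m)%N; set b := (m ^ m)%N => H.
  rewrite -(leq_pmul2l (_ : 0 < m * m)%N) ?muln_gt0 //.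
  have : (2 * m * b <= m * m * b)%N by rewrite leq_mul2r leq_mul2r orbT.
  lia.
rewrite -/m; move: m m0 IH growth => {}n _ IH growth.
rewrite factS !expnS -[n.+1]addn1.
move: growth IH; move: (n`!) (9 ^ n)%N (4 ^ n)%N (n ^ n)%N ((n + 1) ^ n)%N.
move=> f p q b a growth /(leq_mul (leqnn ((n + 1) * 9))) IH.
have := leq_mul (leqnn (3 * (n + 1) * q)) growth.
lia.
Qed.

Local Open Scope ring_scope.

Lemma ln_ge_1BV (R : realType) (x : R) : 0 < x -> 1 - x^-1 <= ln x.
Proof.
move=> x0; have := @le_ln1Dx R (x^-1 - 1).
rewrite [1 + _]addrC subrK lnV ?posrE // => /(_ _).
have : 0 < x^-1 by rewrite invr_gt0.
by lra.
Qed.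

Lemma exp_sqrt_log_le (R : realType) (n s : nat) :
  24 ^+ 8 <= n%:R :> R ->
  s%:R <= Num.sqrt (2 * n%:R * log2 n%:R) + 1 :> R ->
  n%:R ^+ s.+1 <= (9 / 8) ^+ n :> R.
Proof.
move=> n_large les.
have n_gt0 : 0 < n%:R :> R by apply: lt_le_trans n_large; rewrite exprn_gt0.
(* [y] is the eighth root of [n], so that [ln n <= 8 y] and
   [s ln n = O(y^6)] is negligible before [n = y^8]. *)
pose y : R := Num.sqrt (Num.sqrt (Num.sqrt n%:R)).
have y8 : y ^+ 8 = n%:R.
  by rewrite (exprM y 2 4) sqr_sqrtr ?sqrtr_ge0 // (exprM _ 2 2) sqr_sqrtr
             ?sqrtr_ge0 // sqr_sqrtr // ltW.
have y24 : 24 <= y by rewrite -(@ler_pXn2r _ 8) ?nnegrE ?sqrtr_ge0 // y8.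
have y_gt0 : 0 < y by lra.
have ln_n : ln n%:R <= 8 * y.
  rewrite -y8 lnXn // -[_ *+ 8]mulr_natl ler_pM2l //.
  have := @le_ln1Dx R (y - 1); rewrite [1 + _]addrC subrK; lra.
have ln2 : 2^-1 <= ln 2 :> R by have := @ln_ge_1BV R 2; lra.
have ln2_gt0 : 0 < ln 2 :> R by lra.
have sqrt_le : Num.sqrt (2 * n%:R * log2 n%:R) <= 6 * y ^+ 5.
  have y5 : 0 <= 6 * y ^+ 5 by rewrite mulr_ge0 // exprn_ge0 // ltW.
  rewrite -(ger0_norm y5) -sqrtr_sqr ler_wsqrtr //.
  have log_le : log2 n%:R <= 16 * y.
    by rewrite /log2 ler_pdivrMr //; nra.
  apply: (@le_trans _ _ (2 * n%:R * (16 * y))).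
    by rewrite ler_pM2l // mulr_gt0.
  rewrite -y8 exprMn -!exprM.
  have : 0 < y ^+ 9 by rewrite exprn_gt0.
  have -> : y ^+ (5 * 2) = y * y ^+ 9 by rewrite -exprS.
  have -> : 2 * y ^+ 8 * (16 * y) = 32 * y ^+ 9 by rewrite [y ^+ 9]exprS; ring.
  by nra.
have y5_ge1 : 1 <= y ^+ 5 by apply: exprn_ege1; lra.
have s_le : s.+1%:R <= 8 * y ^+ 5 by rewrite -natr1; lra.
have q_gt0 : 0 < 9 / 8 :> R by lra.
have ln98 : 9^-1 <= ln (9 / 8) :> R.
  by have := @ln_ge_1BV R _ q_gt0; rewrite invf_div; lra.
have n0 : 0 < n%:R ^+ s.+1 :> R by rewrite exprn_gt0.
have q0 : 0 < (9 / 8) ^+ n :> R by rewrite exprn_gt0.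
rewrite -ler_ln ?posrE // !lnXn ?posrE //.
rewrite -[ln _ *+ s.+1]mulr_natl -[ln _ *+ n]mulr_natl.
apply: (@le_trans _ _ (8 * y ^+ 5 * (8 * y))).
  apply: ler_pM => //; apply: ln_ge0; rewrite -y8; apply: exprn_ege1; lra.
apply: (@le_trans _ _ (n%:R * 9^-1)); last by rewrite ler_pM2l.
rewrite -y8 (_ : y ^+ 8 = y ^+ 6 * y ^+ 2); last by rewrite -exprD.
rewrite (_ : 8 * y ^+ 5 * (8 * y) = y ^+ 6 * 64); last by ring.
rewrite -[leRHS]mulrA ler_pM2l ?exprn_gt0 //.
by rewrite expr2; nra.
Qed.

Lemma exp_le_expn_bin (R : realType) (n s : nat) : (0 < n)%N ->
  Num.sqrt (2 * n%:R * log2 n%:R) <= s%:R :> R ->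
  n%:R ^+ n <= 2 ^+ 'C(s.+1, 2) :> R.
Proof.
move=> n_gt0 les.
have n1 : 1 <= n%:R :> R by rewrite ler1n.
have nR0 : 0 < n%:R :> R by rewrite ltr0n.
have ln2_gt0 : 0 < ln 2 :> R by have := @ln_ge_1BV R 2; lra.
have log_ge0 : 0 <= 2 * n%:R * log2 n%:R :> R.
  apply: mulr_ge0; first by rewrite mulr_ge0 // ltW.
  by apply: divr_ge0; [exact: ln_ge0 | exact: ltW].
have s2 : 2 * n%:R * log2 n%:R <= s%:R ^+ 2 :> R.
  rewrite -(sqr_sqrtr log_ge0) lerXn2r ?nnegrE ?sqrtr_ge0 //.
have binE : 2 * 'C(s.+1, 2)%:R = s%:R ^+ 2 + s%:R :> R.
  rewrite bin2 -natrX -natrD -natrM; congr _%:R.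
  have := odd_double_half (s.+1 * s)%N.
  by rewrite oddM /= andNb add0n -muln2 mulnC /= => ->; rewrite mulSn -mulnn addnC.
rewrite -ler_ln ?posrE ?exprn_gt0 // !lnXn ?posrE //.
rewrite -[ln _ *+ n]mulr_natl -[ln _ *+ _]mulr_natl.
have -> : ln n%:R = log2 n%:R * ln 2 :> R by rewrite /log2 divfK // gt_eqF.
rewrite mulrA ler_pM2r //.
have : 0 <= s%:R :> R by [].
by lra.
Qed.

Lemma low_inversion_ratio (R : realType) (n s : nat) :
  24 ^+ 8 <= n%:R :> R ->
  Num.sqrt (2 * n%:R * log2 n%:R) <= s%:R :> R ->
  s%:R <= Num.sqrt (2 * n%:R * log2 n%:R) + 1 :> R ->
  #|[set D : digraph 'I_n | tournament D & (inversion_number D + s <= n)%N]|%:R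
    * n%:R
  <= 3 * #|[set D : digraph 'I_n | tournament D]|%:R :> R.
Proof.
move=> n_large les les1.
have nR0 : 0 < n%:R :> R by apply: lt_le_trans n_large; rewrite exprn_gt0.
have n0 : (0 < n)%N by rewrite -(ltr0n R).
have := card_low_inversion n s.
move: #|_| #|_| => T B; rewrite -(ler_nat R) !natrM !natrX => count.
have := exp_sqrt_log_le R n s n_large les1; rewrite exprS => decay.
have pow := exp_le_expn_bin R n s n0 les.
have := fact_exp_le n; rewrite -(ler_nat R) !natrM !natrX => fact.
have {}decay : n%:R * n%:R ^+ s * (2 ^+ n * 4 ^+ n) <= 9 ^+ n :> R.
  rewrite -exprMn (_ : 2 * 4 = 8); last by ring.
  by rewrite -ler_pdivlMr ?exprn_gt0 // -expr_div_n.
have v0 : 0 < n%:R ^+ n :> R by rewrite exprn_gt0.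
have r0 : 0 < 9 ^+ n :> R by rewrite exprn_gt0.
have [p0 q0] : 0 <= 2 ^+ n :> R /\ 0 <= 4 ^+ n :> R by split; apply: exprn_ge0.
have u0 : 0 <= n%:R ^+ s :> R by rewrite exprn_ge0.
have [B0 T0] : 0 <= B%:R :> R /\ 0 <= T%:R :> R by [].
rewrite -(ler_pM2r v0) -(ler_pM2r r0).
move: n0 nR0 count decay pow fact v0 r0 p0 q0 u0 B0 T0 => _.
move: (n`!%:R) (n%:R ^+ n) (n%:R ^+ s) (2 ^+ n) (4 ^+ n) (9 ^+ n) (2 ^+ 'C(_, _)).
move: (B%:R) (T%:R) (n%:R) => b t m f v u p q r w.
move=> m0 count decay pow fact v0 r0 p0 q0 u0 b0 t0.
have h1 : b * (m * r) * v <= b * (m * r) * w.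
  by rewrite ler_wpM2l // !mulr_ge0 // ltW.
have h2 : m * r * (b * w) <= m * r * (f * u * p * t).
  by rewrite ler_wpM2l // mulr_ge0 // ltW.
have h3 : u * p * t * m * (f * r) <= u * p * t * m * (3 * q * v).
  by rewrite ler_wpM2l // !mulr_ge0 // ltW.
have h4 : 3 * v * t * (m * u * (p * q)) <= 3 * v * t * r.
  by rewrite ler_wpM2l // !mulr_ge0 // ltW.
by lra.
Qed.

Lemma random_tournament_prob_le1 (R : realType) (n : nat)
    (P : digraph 'I_n -> bool) : random_tournament_prob R P <= 1.
Proof.
rewrite /random_tournament_prob; set T := #|[set D | tournament D]|.
case: (posnP T) => [->|T0]; first by rewrite invr0 mulr0.
rewrite ler_pdivrMr ?ltr0n // mul1r ler_nat.
by apply/subset_leq_card/subsetP => D; rewrite !inE => /andP[].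
Qed.

Lemma random_tournament_prob_ge (R : realType) (n : nat) :
  24 ^+ 8 <= n%:R :> R ->
  1 - 3 * n%:R^-1 <= random_tournament_prob R (fun D : digraph 'I_n =>
       n%:R - Num.sqrt (2 * n%:R * log2 n%:R) <= (inversion_number D)%:R :> R).
Proof.
move=> n_large; rewrite /random_tournament_prob.
have n0 : 0 < n%:R :> R by apply: lt_le_trans n_large; rewrite exprn_gt0.
set a := Num.sqrt _; pose s := (Num.trunc a).+1.
have /andP[a_ge a_lt] := truncn_itv (sqrtr_ge0 _ : 0 <= a).
have as_le : a <= s%:R by rewrite ltW.
have s_le : s%:R <= a + 1 by rewrite -natr1 lerD2r.
set G := [set D | _ && _]; set T := [set D | _].
have := low_inversion_ratio R n s n_large as_le s_le.
rewrite -/T; set B := [set D | _ & _].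
have T_gt0 : 0 < #|T|%:R :> R.
  rewrite ltr0n lt0n; apply/eqP => T0.
  by have := card_tournaments n; rewrite -/T T0 muln0 leqn0 expn_eq0.
have TGB : #|T|%:R <= #|G|%:R + #|B|%:R :> R.
  rewrite -natrD ler_nat -(cardsID G T); apply: leq_add.
    exact/subset_leq_card/subsetIr.
  apply/subset_leq_card/subsetP => D; rewrite !inE => /andP[nG tD].
  move: nG; rewrite tD /= -ltNge ltrBrDr => lt_n.
  rewrite addnS -(ltr_nat R) natrD.
  by apply: le_lt_trans lt_n; rewrite lerD2l.
move=> ratio; rewrite ler_pdivlMr // mulrBl mul1r mulrAC.
have : #|B|%:R <= 3 * #|T|%:R / n%:R :> R by rewrite ler_pdivlMr.
by lra.
Qed.

Lemma max_inversion_ge (n : nat) (D : digraph 'I_n) :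
  tournament D -> (inversion_number D <= max_inversion_number n)%N.
Proof. by case/andP => oD _; apply: leq_bigmax_cond. Qed.

From mathcomp Require Import all_classical all_reals all_analysis.
Import numFieldNormedType.Exports.
Local Open Scope classical_set_scope.

Theorem theorem1p9 (R : realType) :
  (exists N : nat, forall n : nat, (N <= n)%N ->
     n%:R - Num.sqrt (2 * n%:R * log2 n%:R) <= (max_inversion_number n)%:R :> R)
  /\
  ((fun n : nat => random_tournament_prob R (fun D : digraph 'I_n =>
       n%:R - Num.sqrt (2 * n%:R * log2 n%:R) <= (inversion_number D)%:R :> R))
     @ \oo --> (1 : R)).
Proof.
split.
  have [N _ large] := nbhs_infty_ger (24 ^+ 8 : R).
  exists N => n /large /= n_large.
  have n3 : 3 * n%:R^-1 < 1 :> R.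
    have lt3 : 3 < n%:R :> R by apply: lt_le_trans n_large; lra.
    by rewrite ltr_pdivrMr; lra.
  have := random_tournament_prob_ge R n n_large.
  rewrite /random_tournament_prob; set G := finset _.
  have [G0|[D]] := set_0Vmem G; first by rewrite G0 cards0 mul0r; lra.
  rewrite inE => /andP[tD leD] _; apply: le_trans leD _.
  by rewrite ler_nat max_inversion_ge.
apply: (@squeeze_cvgr _ _ _ _ (fun n => 1 - 3 * n%:R^-1) (fun=> 1)).
- near=> n; rewrite random_tournament_prob_le1 andbT.
  by apply: random_tournament_prob_ge; near: n; apply: nbhs_infty_ger.
- rewrite -[X in _ --> X]subr0 -[X in _ - X](mulr0 3).
  apply: cvgB; first exact: cvg_cst.
  apply: cvgMl_tmp; rewrite -cvg_shiftS; exact: cvg_harmonic.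
- exact: cvg_cst.
Unshelve. all: by end_near.
Qed.
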